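(* Let $V$ be a finite union of $\mathbb{R}$-rational polyhedral sets in $\mathbb{R}^n$. Then there exist $f_1,f_2\in\overline{\boldsymbol{T}[X_1,\ldots,X_n]}$ such that $$\boldsymbol{E}(V)_1=\left\{(g,h)\in\overline{\boldsymbol{T}[X_1,\ldots,X_n]}\times\overline{\boldsymbol{T}[X_1,\ldots,X_n]}\;\middle|\;\exists k\in\mathbb{Z}_{>0}:\ \left(g\odot f_2^{\odot k},\,h\odot f_2^{\odot k}\right)\in\langle(f_1,f_2)\rangle\right\}$$ and $f_1(x)\ge f_2(x)$ for any $x\in\boldsymbol{T}^n$. In particular, if $f_2$ is taken as a constant tropical monomial given by a real number, then $\boldsymbol{E}(V)_1=\langle(f_1,f_2)\rangle$ holds.
   Context: The tropical semifield is $\boldsymbol{T}=\mathbb{R}\cup\{-\infty\}$ with $a\oplus b=\max\{a,b\}$ and $a\odot b=a+b$ (and $a\oplus(-\infty)=a$, $a\odot(-\infty)=-\infty$); its zero is $-\infty$ and its one is $0$. $\boldsymbol{T}[X_1,\ldots,X_n]$ is the semiring of (formal) tropical polynomials, and the tropical polynomial function semiring $\overline{\boldsymbol{T}[X_1,\ldots,X_n]}$ is its quotient identifying two tropical polynomials when they define the same function on $\boldsymbol{T}^n$. $f^{\odot k}$ denotes the $k$-th tropical power. A congruence on a semiring $S$ is a subset $E\subset S\times S$ that is an equivalence relation on $S$ and is closed under componentwise addition and multiplication. $\langle(f_1,f_2)\rangle$ denotes the smallest congruence on $\overline{\boldsymbol{T}[X_1,\ldots,X_n]}$ containing $(f_1,f_2)$.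 For $V\subset\boldsymbol{T}^n$ (in particular $V\subset\mathbb{R}^n$), $\boldsymbol{E}(V)_1=\{(f,g)\in\overline{\boldsymbol{T}[X_1,\ldots,X_n]}^2\mid f(x)=g(x)\text{ for all }x\in V\}$, a congruence on $\overline{\boldsymbol{T}[X_1,\ldots,X_n]}$. A polyhedral set in $\mathbb{R}^n$ is the solution set of a finite system of linear inequalities $c_i\cdot y+a_i\le 0$ ($c_i\in\mathbb{R}^n$, $a_i\in\mathbb{R}$); it is $\mathbb{R}$-rational if all coefficients other than the constant terms are rational (i.e. $c_i\in\mathbb{Q}^n$, $a_i\in\mathbb{R}$). *)

(* Defs.v *)
From HB Require Import structures.
From mathcomp Require Import all_boot all_order all_algebra.
From mathcomp Require Import all_classical reals.

Set Implicit Arguments.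
Unset Strict Implicit.
Unset Printing Implicit Defensive.

Import Order.TTheory GRing.Theory Num.Theory.

Local Open Scope classical_set_scope.
Local Open Scope ring_scope.
Local Open Scope quotient_scope.

(* Tropical semifield: None is -oo and Some a is the real number a.  The
   tropical sum and product are the + and * of the semiring instance below, so
   that 0 : trop R is -oo, 1 : trop R is the real number 0, and x ^+ k is the
   k-th tropical power. *)
Definition trop (R : realType) : Type := option R.

HB.instance Definition _ (R : realType) := Choice.on (trop R).

Definition tfin (R : realType) (a : R) : trop R := Some a.

Section Tropical.
Variable R : realType.
Implicit Types a b c : trop R.

Definition tadd a b : trop R :=
  match a, b with
  | None, _ => b
  | _, None => a
  | Some x, Some y => Some (Num.max x y)
  end.

Definition tmul a b : trop R :=
  match a, b with
  | Some x, Some y => Some (x + y)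
  | _, _ => None
  end.

Definition tle a b : bool :=
  match a, b with
  | None, _ => true
  | Some _, None => false
  | Some x, Some y => x <= y
  end.

Fact taddA : associative tadd.
Proof. by move=> [x|] [y|] [z|] //=; rewrite maxA. Qed.

Fact taddC : commutative tadd.
Proof. by move=> [x|] [y|] //=; rewrite maxC. Qed.

Fact tadd0 : left_id (None : trop R) tadd.
Proof. by case. Qed.

Fact tmulA : associative tmul.
Proof. by move=> [x|] [y|] [z|] //=; rewrite addrA. Qed.

Fact tmulC : commutative tmul.
Proof. by move=> [x|] [y|] //=; rewrite addrC. Qed.

Fact tmul1 : left_id (tfin 0) tmul.
Proof. by case=> [x|] //=; rewrite add0r. Qed.

Fact tmulD : left_distributive tmul tadd.
Proof. by move=> [x|] [y|] [z|] //=; rewrite addr_maxl. Qed.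

Fact tmul0 : left_zero (None : trop R) tmul.
Proof. by []. Qed.

Fact tone_neq0 : tfin 0 != None :> trop R.
Proof. by []. Qed.

HB.instance Definition _ := GRing.isNmodule.Build (trop R) taddA taddC tadd0.
HB.instance Definition _ := GRing.Nmodule_isComNzSemiRing.Build (trop R)
  tmulA tmulC tmul1 tmulD tmul0 tone_neq0.

End Tropical.

(* Formal tropical polynomials, T[X_1, ..., X_n] = T[X_1, ..., X_(n-1)][X_n]. *)
Fixpoint tpoly (R : realType) (n : nat) : comNzSemiRingType :=
  if n is m.+1 then {poly (tpoly R m)} else trop R.

Fixpoint tpolyC (R : realType) (n : nat) (a : trop R) : tpoly R n :=
  match n return tpoly R n with
  | 0%N => a
  | m.+1 => (tpolyC m a)%:P
  end.

Fixpoint teval (R : realType) (n : nat) :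
    ('I_n -> trop R) -> tpoly R n -> trop R :=
  match n return ('I_n -> trop R) -> tpoly R n -> trop R with
  | 0%N => fun _ p => p
  | m.+1 => fun x p =>
      (map_poly (teval (fun i : 'I_m => x (widen_ord (leqnSn m) i))) p).[x ord_max]
  end.

Section Evaluation.
Variable R : realType.

Let teval_morph n (x : 'I_n -> trop R) :
  nmod_morphism (teval x) * monoid_morphism (teval x).
Proof.
elim: n x => [|n IHn] x; first by [].
pose x' (i : 'I_n) := x (widen_ord (leqnSn n) i).
pose aM := GRing.isNmodMorphism.Build _ _ (teval x') (IHn x').1.
pose mM := GRing.isMonoidMorphism.Build _ _ (teval x') (IHn x').2.
pose f : {rmorphism tpoly R n -> trop R} :=
  HB.pack (teval x') aM mM.
have E p : teval x p = (map_poly f p).[x ord_max] by [].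
split; split.
- by rewrite E rmorph0 horner0.
- by move=> p q; rewrite !E rmorphD hornerD.
- by rewrite E rmorph1 hornerC.
- by move=> p q; rewrite !E rmorphM hornerM.
Qed.

HB.instance Definition _ n (x : 'I_n -> trop R) :=
  GRing.isNmodMorphism.Build _ _ (teval x) (teval_morph x).1.
HB.instance Definition _ n (x : 'I_n -> trop R) :=
  GRing.isMonoidMorphism.Build _ _ (teval x) (teval_morph x).2.

Lemma tevalC n (x : 'I_n -> trop R) a : teval x (tpolyC n a) = a.
Proof. by elim: n x => //= n IHn x; rewrite map_polyC hornerC; apply: IHn. Qed.

End Evaluation.

Section PolynomialFunctions.
Variables (R : realType) (n : nat).

Definition same_fun (p q : tpoly R n) : bool :=
  `[< forall x : 'rV[trop R]_n, teval (x 0) p = teval (x 0) q >].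

Fact same_fun_refl : reflexive same_fun.
Proof. by move=> p; apply/asboolP. Qed.

Fact same_fun_sym : symmetric same_fun.
Proof. by move=> p q; apply/asboolP/asboolP => pq x; rewrite pq. Qed.

Fact same_fun_trans : transitive same_fun.
Proof.
by move=> q p r /asboolP pq /asboolP qr; apply/asboolP => x; rewrite pq.
Qed.

Canonical same_fun_equiv :=
  EquivRel same_fun same_fun_refl same_fun_sym same_fun_trans.

Definition tpfun : Type := {eq_quot same_fun}.

HB.instance Definition _ := Choice.on tpfun.
HB.instance Definition _ := EqQuotient.on tpfun.

Definition tpf_eval (f : tpfun) (x : 'rV[trop R]_n) : trop R :=
  teval (x 0) (repr f).

Lemma tpf_eval_pi p x : tpf_eval (\pi_tpfun p) x = teval (x 0) p.
Proof.
have /eqmodP/asboolP : \pi_tpfun (repr (\pi_tpfun p)) = \pi_tpfun p.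
  by rewrite reprK.
exact.
Qed.

Lemma tpf_evalP f g : (forall x, tpf_eval f x = tpf_eval g x) -> f = g.
Proof. by move=> fg; rewrite -[f]reprK -[g]reprK; apply/eqmodP/asboolP. Qed.

Definition tpf0 : tpfun := \pi_tpfun 0.
Definition tpf1 : tpfun := \pi_tpfun 1.
Definition tpf_add (f g : tpfun) : tpfun := \pi_tpfun (repr f + repr g).
Definition tpf_mul (f g : tpfun) : tpfun := \pi_tpfun (repr f * repr g).
Definition tpf_const (a : trop R) : tpfun := \pi_tpfun (tpolyC n a).

Let eval0 x : tpf_eval tpf0 x = 0.
Proof. by rewrite tpf_eval_pi rmorph0. Qed.
Let eval1 x : tpf_eval tpf1 x = 1.
Proof. by rewrite tpf_eval_pi rmorph1. Qed.
Let evalD f g x : tpf_eval (tpf_add f g) x = tpf_eval f x + tpf_eval g x.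
Proof. by rewrite tpf_eval_pi rmorphD. Qed.
Let evalM f g x : tpf_eval (tpf_mul f g) x = tpf_eval f x * tpf_eval g x.
Proof. by rewrite tpf_eval_pi rmorphM. Qed.

Fact tpf_addA : associative tpf_add.
Proof. by move=> f g h; apply: tpf_evalP => x; rewrite !evalD addrA. Qed.

Fact tpf_addC : commutative tpf_add.
Proof. by move=> f g; apply: tpf_evalP => x; rewrite !evalD addrC. Qed.

Fact tpf_add0 : left_id tpf0 tpf_add.
Proof. by move=> f; apply: tpf_evalP => x; rewrite evalD eval0 add0r. Qed.

Fact tpf_mulA : associative tpf_mul.
Proof. by move=> f g h; apply: tpf_evalP => x; rewrite !evalM mulrA. Qed.

Fact tpf_mulC : commutative tpf_mul.
Proof. by move=> f g; apply: tpf_evalP => x; rewrite !evalM mulrC. Qed.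

Fact tpf_mul1 : left_id tpf1 tpf_mul.
Proof. by move=> f; apply: tpf_evalP => x; rewrite evalM eval1 mul1r. Qed.

Fact tpf_mulD : left_distributive tpf_mul tpf_add.
Proof.
by move=> f g h; apply: tpf_evalP => x; rewrite !(evalM, evalD) mulrDl.
Qed.

Fact tpf_mul0 : left_zero tpf0 tpf_mul.
Proof. by move=> f; apply: tpf_evalP => x; rewrite evalM eval0 mul0r. Qed.

Fact tpf_one_neq0 : tpf1 != tpf0.
Proof.
by apply/eqP => /(congr1 (tpf_eval^~ 0)); rewrite eval1 eval0 => /eqP.
Qed.

HB.instance Definition _ :=
  GRing.isNmodule.Build tpfun tpf_addA tpf_addC tpf_add0.
HB.instance Definition _ := GRing.Nmodule_isComNzSemiRing.Build tpfun
  tpf_mulA tpf_mulC tpf_mul1 tpf_mulD tpf_mul0 tpf_one_neq0.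

End PolynomialFunctions.

Section Congruences.
Variable S : comNzSemiRingType.

Record is_congruence (E : set (S * S)) : Prop := IsCongruence {
  congr_refl : forall f, E (f, f);
  congr_sym : forall f g, E (f, g) -> E (g, f);
  congr_trans : forall f g h, E (f, g) -> E (g, h) -> E (f, h);
  congr_add : forall f g f' g', E (f, g) -> E (f', g') -> E (f + f', g + g');
  congr_mul : forall f g f' g', E (f, g) -> E (f', g') -> E (f * f', g * g') }.

Definition gen_congruence (f g : S) : set (S * S) :=
  smallest is_congruence [set (f, g)].

End Congruences.

Section Geometry.
Variables (R : realType) (n : nat).

Definition E1 (V : set 'rV[trop R]_n) : set (tpfun R n * tpfun R n) :=
  [set fg | forall x, V x -> tpf_eval fg.1 x = tpf_eval fg.2 x].

Definition in_trop (V : set 'rV[R]_n) : set 'rV[trop R]_n :=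
  map_mx (@tfin R) @` V.

Definition rational_polyhedral (P : set 'rV[R]_n) : Prop :=
  exists (m : nat) (c : 'M[rat]_(m, n)) (a : 'I_m -> R),
    P = [set y | forall i, \sum_(j < n) ratr (c i j) * y 0 j + a i <= 0].

Definition rational_polyhedral_union (V : set 'rV[R]_n) : Prop :=
  exists (m : nat) (P : 'I_m -> set 'rV[R]_n),
    (forall i, rational_polyhedral (P i)) /\ V = \bigcup_i P i.

End Geometry.

(* Main.v *)
Require Import Defs.
From HB Require Import structures.
From mathcomp Require Import all_boot all_order all_algebra.
From mathcomp Require Import all_classical reals.
From mathcomp Require Import ring lra.
Import Order.TTheory GRing.Theory Num.Theory.
Local Open Scope classical_set_scope.
Local Open Scope ring_scope.

(** The idea is to choose [f1 >= f2] so that the gap [f1 - f2] vanishes exactly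
    on [V] and, up to a factor, dominates every gap [h - g] of polynomial
    functions with [h <= g] on [V].

    Suppose such a pair is given, and let [g = h] on [V].  For some [k] we have
    [h + k f2 <= g + k f1] in ordinary notation.  In the congruence generated
    by [(f1, f2)] this squeezes [g f2^k]: it is congruent to [g f1^k], which
    absorbs [h f2^k], so it equals [g f1^k + h f2^k], which is congruent to
    [(g + h) f2^k] ([congruence_squeeze]).  Exchanging [g] and [h] gives
    [g f2^k ~ h f2^k].  Conversely, [E1 V] is a congruence containing
    [(f1, f2)], and [f2] is finite on [V], hence can be cancelled there.

    The predicate [separates] records the properties of the pair, and the pair
    is built piece by piece.  A rational polyhedron is cut out, after clearing
    denominators, by inequalities [m+ <= m-] between tropical monomials
    ([rational_polyhedral_cell]); one takes for [f1] the product of all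
    [m+ + m-] and for [f2] the product of all [m-], so that the gap is
    [sum_c max(0, m+ - m-)].  For unions one uses the identity
    [min(p - q, p' - q') = p + p' - max(q + p', q' + p)]
    ([separates_setU]).

    That the gap of a nonempty polyhedron dominates [h - g] is linear
    programming duality: the function [u - g], with [u] a monomial of [h], is
    concave and nonpositive on the polyhedron, and it must be bounded by a
    multiple of the constraint violation ([affine_domination]).  This follows
    from a Farkas lemma stated as an estimate ([farkas_estimate]).  The
    resulting inequality holds on [R^n]; it extends to points with infinite
    coordinates because a tropical polynomial inequality may be checked at the
    finite points ([tle_everywhere]). *)

Set Implicit Arguments.
Unset Strict Implicit.
Unset Printing Implicit Defensive.

(** * Linear inequalities *)

Lemma scalarfZ (R : pzRingType) (W : lmodType R) (f : W -> R) :
  scalar f -> forall a x, f (a *: x) = a * f x.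
Proof.
move=> fL a x; have f0 : f 0 = 0.
  by have := fL (-1) 0 0; rewrite scaler0 addr0 mulN1r addNr.
by rewrite -[a *: x]addr0 fL f0 addr0.
Qed.

(** Bounding [g] by a multiple of the total violation of the constraints,
    instead of writing it as a nonnegative combination of them, keeps the
    content of Farkas' lemma and avoids handling coefficients.  The induction
    on the constraints is Bartl's: if the constraint [a] cannot be dropped,
    there is a point [x0] satisfying the others with [g x0 > 0], hence
    [A a x0 > 0]; projecting along [x0] onto the kernel of [A a] removes [a]
    from the system. *)
Lemma farkas_estimate (R : realFieldType) (W : lmodType R) (T : eqType)
    (s : seq T) (A : T -> W -> R) (g : W -> R) :
  (forall i, scalar (A i)) -> scalar g ->
  (forall x, {in s, forall i, A i x <= 0} -> g x <= 0) ->
  exists2 K, 0 <= K & forall x, g x <= K * \sum_(i <- s) Num.max 0 (A i x).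
Proof.
elim: s A g => [|a s IHs] A g AL gL gle0.
  by exists 0 => // x; rewrite mul0r gle0.
have sum_ge0 x : 0 <= \sum_(i <- s) Num.max 0 (A i x).
  by apply: sumr_ge0 => i _; rewrite le_max lexx.
have [red|] := pselect (forall x, {in s, forall i, A i x <= 0} -> g x <= 0).
  have [K K0 gK] := IHs A g AL gL red; exists K => // x.
  apply: le_trans (gK x) _; rewrite big_cons ler_wpM2l // lerDr.
  by rewrite le_max lexx.
move=> /existsNP[x0 /not_implyP[Ax0 /negP]]; rewrite -ltNge => gx0.
have ax0 : 0 < A a x0.
  rewrite ltNge; apply/negP => ax0; move: gx0; rewrite ltNge => /negP; apply.
  by apply: gle0 => i; rewrite inE => /predU1P[->|/Ax0].
(* [A'] and [g'] are [A a x0] times the compositions of [A] and [g] with the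
   projection along [x0] onto the kernel of [A a]; multiplying avoids a
   division. *)
pose A' i x := A a x0 * A i x - A i x0 * A a x.
pose g' x := A a x0 * g x - g x0 * A a x.
have A'L i : scalar (A' i) by move=> c x y; rewrite /A' !AL; ring.
have g'L : scalar g' by move=> c x y; rewrite /g' AL gL; ring.
have [|K K0 gK] := IHs A' g' A'L g'L.
  move=> x A'x; have := gle0 ((- A a x) *: x0 + A a x0 *: x).
  rewrite gL scalarfZ // => H.
  have -> : g' x = - A a x * g x0 + A a x0 * g x by rewrite /g'; ring.
  apply: H => i; rewrite AL scalarfZ // inE => /predU1P[->|/A'x].
    by rewrite mulrC mulrN addNr.
  by rewrite /A'; lra.
pose C := \sum_(i <- s) `|A i x0|.
have C0 : 0 <= C by apply: sumr_ge0.
have A'le x : \sum_(i <- s) Num.max 0 (A' i x) <=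
    A a x0 * \sum_(i <- s) Num.max 0 (A i x) + C * Num.max 0 (A a x).
  rewrite mulr_sumr mulr_suml -big_split /= big_seq [leRHS]big_seq.
  apply: ler_sum => i si; rewrite (ler0_norm (Ax0 i si)) /A'.
  have A0 := Ax0 i si; set m := Num.max 0 (A i x); set m' := Num.max 0 (A a x).
  have [m0 m1] : 0 <= m /\ A i x <= m by rewrite !le_max !lexx orbT.
  have [m0' m1'] : 0 <= m' /\ A a x <= m' by rewrite !le_max !lexx orbT.
  rewrite ge_max; apply/andP; split; nra.
(* Solving the estimate for [g'] for [g] costs [K C + g x0] times the violation
   of [a], divided by [A a x0]. *)
exists (K + (K * C + g x0) / A a x0) => [|x].
  by rewrite addr_ge0 // divr_ge0 ?ltW // ltr_wpDl // mulr_ge0.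
rewrite big_cons; have := le_trans (gK x) (ler_wpM2l K0 (A'le x)).
have := sum_ge0 x; set S := \sum_(i <- s) _.
have [m0' m1'] : 0 <= Num.max 0 (A a x) /\ A a x <= Num.max 0 (A a x).
  by rewrite !le_max !lexx orbT.
set m := Num.max 0 (A a x) in m0' m1' *; rewrite /g' => S0 gS.
rewrite -(ler_pM2l ax0).
have -> : A a x0 * ((K + (K * C + g x0) / A a x0) * (m + S)) =
   K * A a x0 * (m + S) + (K * C + g x0) * (m + S) by field; rewrite gt_eqF.
have : 0 <= K * A a x0 * m by rewrite !mulr_ge0 // ltW.
have : 0 <= (K * C + g x0) * S by rewrite mulr_ge0 // addr_ge0 ?mulr_ge0 // ltW.
have : g x0 * A a x <= g x0 * m by rewrite ler_wpM2l // ltW.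
nra.
Qed.

Definition aff (R : realType) n (l : 'rV[R]_n * R) (y : 'rV[R]_n) : R :=
  \sum_j l.1 0 j * y 0 j + l.2.

Lemma seq_argmax (R : realType) (T : eqType) (f : T -> R) (s : seq T) x0 :
  x0 \in s -> exists2 x, x \in s & {in s, forall y, f y <= f x}.
Proof.
elim: s x0 => // a [|b s] IHs x0 _.
  by exists a; rewrite ?mem_head // => y; rewrite inE => /eqP ->.
have [x sx xmax] := IHs b (mem_head _ _).
have [le_ax|/ltW le_xa] := leP (f a) (f x).
  exists x; first by rewrite inE sx orbT.
  by move=> y; rewrite inE => /predU1P[->|/xmax].
exists a; rewrite ?mem_head // => y; rewrite inE => /predU1P[->//|/xmax].
by move=> /le_trans; apply.
Qed.

(** Nonemptiness of the polyhedron is essential: on an empty one the hypothesis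
    on [u] is void, and the violation of the constraints may stay bounded while
    [u - max G] does not.

    The statement is Farkas' lemma for the linear programme maximising [w]
    subject to [w <= u - v] for [v] in [G] and to the constraints [ls].  It is
    homogenised by a variable [z >= 0], so that a triple [(c, b, d)] stands
    both for a point [(y, z, w)] and for the functional
    [c . y + b z + d w]. *)
Lemma affine_domination (R : realType) n (ls G : seq ('rV[R]_n * R)) u :
  (exists y, {in ls, forall l, aff l y <= 0}) ->
  (forall y, {in ls, forall l, aff l y <= 0} ->
     exists2 v, v \in G & aff u y <= aff v y) ->
  exists K : nat, forall y, exists2 v, v \in G &
    aff u y <= aff v y + K%:R * \sum_(l <- ls) Num.max 0 (aff l y).
Proof.
move=> [y0 Py0] uG.
pose W : lmodType R := ('rV[R]_n * R^o * R^o)%type.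
pose A (t x : 'rV[R]_n * R * R) : R :=
  \sum_j t.1.1 0 j * x.1.1 0 j + t.1.2 * x.1.2 + t.2 * x.2.
have AL t : scalar (A t : W -> R).
  move=> a [[y z] w] [[y' z'] w'].
  change (A t (a *: y + y', a * z + z', a * w + w') =
    a * A t (y, z, w) + A t (y', z', w')).
  rewrite /A /=.
  have -> : \sum_j t.1.1 0 j * (a *: y + y') 0 j =
      a * \sum_j t.1.1 0 j * y 0 j + \sum_j t.1.1 0 j * y' 0 j.
    rewrite mulr_sumr -big_split /=; apply: eq_bigr => j _.
    by rewrite !mxE; ring.
  by ring.
pose s : seq ('rV[R]_n * R * R) := (0, -1, 0) :: [seq (l, 0) | l <- ls] ++
  [seq (v.1 - u.1, v.2 - u.2, 1) | v <- G].
have AlE l y z w : A (l, 0) (y, z, w) = \sum_j l.1 0 j * y 0 j + l.2 * z.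
  by rewrite /A /= mul0r addr0.
have AvE v y z w : A (v.1 - u.1, v.2 - u.2, 1) (y, z, w) =
    A (v, 0) (y, z, w) - A (u, 0) (y, z, w) + w.
  rewrite !AlE /A /= mul1r.
  have -> : \sum_j (v.1 - u.1) 0 j * y 0 j =
     \sum_j v.1 0 j * y 0 j - \sum_j u.1 0 j * y 0 j.
    by rewrite -sumrB; apply: eq_bigr => j _; rewrite !mxE mulrBl.
  by ring.
have A1E l y w : A (l, 0) (y, 1, w) = aff l y by rewrite AlE mulr1.
pose g (x : 'rV[R]_n * R * R) : R := x.2.
have gL : scalar (g : W -> R) by move=> a [[? ?] ?] [[? ?] ?].
have [|K K0 gK] := @farkas_estimate R W _ s A g AL gL.
  move=> [[y z] w] As; rewrite /g /= leNgt; apply/negP => w0.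
  have z0 : 0 <= z.
    have := As (0, -1, 0) (mem_head _ _); rewrite /A /= big1; first by lra.
    by move=> j _; rewrite mxE mul0r.
  (* For [z > 0] one would rescale [(y, z)] into the polyhedron; adding a
     small multiple [e] of the feasible point [y0] covers [z = 0] as well.  The
     value of [e] makes the perturbation of [u - v] smaller than [w] for every
     [v]. *)
  pose D := \sum_(v <- G) `|aff v y0 - aff u y0|.
  have D0 : 0 <= D by apply: sumr_ge0.
  pose e := w / (1 + D).
  have D1 : 0 < 1 + D by lra.
  have e0 : 0 < e by rewrite divr_gt0.
  have ze0 : 0 < z + e by lra.
  pose y' := (z + e)^-1 *: (y + e *: y0).
  have y'E l : (z + e) * aff l y' = A (l, 0) (y, z, w) + e * aff l y0.
    rewrite AlE /aff mulrDr mulr_sumr.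
    have -> : \sum_j (z + e) * (l.1 0 j * y' 0 j) =
       \sum_j l.1 0 j * y 0 j + e * \sum_j l.1 0 j * y0 0 j.
      rewrite mulr_sumr -big_split /=; apply: eq_bigr => j _.
      by rewrite !mxE /=; field; rewrite gt_eqF.
    by ring.
  have [l ls_l|v Gv] := uG y'.
    rewrite -(pmulr_rle0 _ ze0) y'E.
    have Al : A (l, 0) (y, z, w) <= 0.
      by apply: As; rewrite inE mem_cat map_f // orbT.
    have := Py0 l ls_l; nra.
  rewrite -(ler_pM2l ze0) !y'E => uv.
  have : A (v.1 - u.1, v.2 - u.2, 1) (y, z, w) <= 0.
    apply: As; rewrite inE mem_cat.
    by rewrite (map_f (fun v => (v.1 - u.1, v.2 - u.2, 1))) // !orbT.
  rewrite AvE => Av.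
  have : e * (aff v y0 - aff u y0) <= e * D.
    rewrite ler_pM2l //; apply: le_trans (ler_norm _) _.
    by rewrite /D (big_rem v) //= lerDl sumr_ge0.
  have : e * (1 + D) = w by rewrite divfK // gt_eqF.
  by lra.
have [k kK] : exists k : nat, K <= k%:R.
  by exists (Num.bound K); rewrite ltW // archi_boundP.
exists k => y.
have [v0 Gv0 _] := uG y0 Py0.
have [v Gv vmax] := seq_argmax (fun v => aff v y) Gv0; exists v => //.
(* At [w = u - max G] the constraints coming from [z] and [G] hold, so only
   those coming from [ls] contribute to the estimate. *)
have := gK (y, 1, aff u y - aff v y).
rewrite /g /s big_cons big_cat /= !big_map.
rewrite [X in Num.max 0 X](_ : _ = -1) ?max_l ?lerN10 //; last first.
  rewrite /A /= big1 => [|j _]; last by rewrite mxE mul0r.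
  by ring.
rewrite [X in _ + (_ + X)](_ : _ = 0); last first.
  rewrite big_seq big1 // => w Gw; rewrite max_l // AvE !A1E.
  by have := vmax w Gw; lra.
under eq_bigr do rewrite A1E.
rewrite add0r addr0 => guv; rewrite -lerBlDl; apply: (le_trans guv).
by rewrite ler_wpM2r // sumr_ge0 // => l _; rewrite le_max lexx.
Qed.

(** * The order of the tropical semifield *)

Section TropicalOrder.
Variable R : realType.
Implicit Types a b c d : trop R.

Lemma tle_refl a : tle a a.
Proof. by case: a => //= x; apply: lexx. Qed.

Lemma tle_trans b a c : tle a b -> tle b c -> tle a c.
Proof. by case: a b c => [x|] [y|] [z|] //=; apply: le_trans. Qed.

Lemma tle_addP a b : tle a b <-> a + b = b.
Proof.
rewrite -[a + b]/(tadd a b); case: a b => [x|] [y|] //=; split=> [|[]].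
  by move=> /max_idPr ->.
by move=> /max_idPr.
Qed.

Lemma tadd_total a b : a + b = a \/ a + b = b.
Proof.
rewrite -[a + b]/(tadd a b); case: a b => [x|] [y|] /=; try by [left|right].
by case: (leP x y); [right|left].
Qed.

Lemma tle_add a b c : tle a c -> tle b c -> tle (a + b) c.
Proof. by case: (tadd_total a b) => ->. Qed.

Lemma tle_addl a b : tle a (a + b).
Proof.
rewrite -[a + b]/(tadd a b).
by case: a b => [x|] [y|] //=; rewrite ?lexx // le_max lexx.
Qed.

Lemma tle_mul a b c d : tle a b -> tle c d -> tle (a * c) (b * d).
Proof.
rewrite -[a * c]/(tmul a c) -[b * d]/(tmul b d).
by case: a b c d => [x|] [y|] [z|] [w|] //=; apply: lerD.
Qed.

Lemma tle_exp k a b : tle a b -> tle (a ^+ k) (b ^+ k).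
Proof.
by move=> ab; elim: k => [|k IHk]; rewrite ?tle_refl // !exprS tle_mul.
Qed.

Lemma tle_sum (I : eqType) (s : seq I) (F : I -> trop R) c :
  {in s, forall i, tle (F i) c} -> tle (\sum_(i <- s) F i) c.
Proof.
move=> Fc; rewrite big_seq; elim/big_ind: _ => // a b; exact: tle_add.
Qed.

Lemma tle_sum_term (I : eqType) (s : seq I) (F : I -> trop R) i :
  i \in s -> tle (F i) (\sum_(j <- s) F j).
Proof. by move=> si; rewrite (big_rem i) //=; apply: tle_addl. Qed.

Lemma tle_fin_sum (I : eqType) (s : seq I) (F : I -> trop R) r :
  tle (tfin r) (\sum_(i <- s) F i) -> exists2 i, i \in s & tle (tfin r) (F i).
Proof.
elim: s => [|i s IHs]; first by rewrite big_nil.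
rewrite big_cons; case: (tadd_total (F i) (\sum_(j <- s) F j)) => -> rF.
  by exists i; rewrite ?mem_head.
by have [j sj rj] := IHs rF; exists j; rewrite // inE sj orbT.
Qed.

Lemma tmulIr c a b : c != 0 -> a * c = b * c -> a = b.
Proof.
rewrite -[a * c]/(tmul a c) -[b * c]/(tmul b c).
by case: c a b => [z|] [x|] [y|] //= _ [/addIr ->].
Qed.

Lemma tmul_neq0 a b : a != 0 -> b != 0 -> a * b != 0.
Proof. by case: a b => [x|] [y|]. Qed.

Lemma tfinX k (x : R) : tfin x ^+ k = tfin (x *+ k).
Proof. by elim: k => // k IHk; rewrite exprS IHk mulrS. Qed.

Lemma tfin_prod I (s : seq I) (F : I -> R) :
  \prod_(i <- s) tfin (F i) = tfin (\sum_(i <- s) F i).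
Proof. by apply/esym; apply: (big_morph (@tfin R)). Qed.

End TropicalOrder.

(** * Tropical polynomials as maxima of monomials *)

Section PolynomialFunctions.
Variables (R : realType) (n : nat).
Implicit Types (f g : tpfun R n) (x : 'rV[trop R]_n).

Lemma tpf_evalD f g x : tpf_eval (f + g) x = tpf_eval f x + tpf_eval g x.
Proof. by rewrite tpf_eval_pi rmorphD. Qed.

Lemma tpf_evalM f g x : tpf_eval (f * g) x = tpf_eval f x * tpf_eval g x.
Proof. by rewrite tpf_eval_pi rmorphM. Qed.

Lemma tpf_eval0 x : tpf_eval 0 x = 0.
Proof. by rewrite tpf_eval_pi rmorph0. Qed.

Lemma tpf_eval1 x : tpf_eval 1 x = 1.
Proof. by rewrite tpf_eval_pi rmorph1. Qed.

Lemma tpf_evalX f k x : tpf_eval (f ^+ k) x = tpf_eval f x ^+ k.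
Proof. by elim: k => [|k IHk]; rewrite ?tpf_eval1 // !exprS tpf_evalM IHk. Qed.

Lemma tpf_evalC a x : tpf_eval (tpf_const n a) x = a.
Proof. by rewrite tpf_eval_pi tevalC. Qed.

Lemma tpf_eval_prod I (s : seq I) (F : I -> tpfun R n) x :
  tpf_eval (\prod_(i <- s) F i) x = \prod_(i <- s) tpf_eval (F i) x.
Proof.
apply: (big_morph (fun f => tpf_eval f x)) => [f g|].
  exact: tpf_evalM.
exact: tpf_eval1.
Qed.

End PolynomialFunctions.

Definition monomial (R : realType) (n : nat) : Type :=
  (R * {ffun 'I_n -> nat})%type.
HB.instance Definition _ R n := Choice.on (monomial R n).

Section Monomials.
Variable R : realType.

Definition tmon n (m : monomial R n) (x : 'I_n -> trop R) : trop R :=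
  tfin m.1 * \prod_j x j ^+ m.2 j.

Definition rmon n (m : monomial R n) (y : 'rV[R]_n) : R :=
  m.1 + \sum_j y 0 j *+ m.2 j.

Lemma tmon_fin n (m : monomial R n) y :
  tmon m (map_mx (@tfin R) y 0) = tfin (rmon m y).
Proof.
rewrite /tmon (eq_bigr (fun j => tfin (y 0 j *+ m.2 j))) ?tfin_prod // => j _.
by rewrite mxE tfinX.
Qed.

Lemma teval_monomials n (p : tpoly R n) :
  exists s : seq (monomial R n), forall x, teval x p = \sum_(m <- s) tmon m x.
Proof.
elim: n p => [|n IHn] p.
  case: p => [a|]; last by exists [::] => x; rewrite big_nil.
  exists [:: (a, [ffun=> 0%N])] => x.
  by rewrite big_seq1 /tmon big_ord0 mulr1.
have /choice[S SE] := fun i => IHn p`_i.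
(* The monomial [m] times the [i]-th power of the last variable. *)
pose ext i (m : monomial R n) : monomial R n.+1 :=
  (m.1, [ffun j => oapp m.2 i (unlift ord_max j)]).
exists (flatten [seq [seq ext i m | m <- S i] | i <- iota 0 (size p)]) => x.
rewrite big_flatten big_map /=.
pose x' j := x (widen_ord (leqnSn n) j).
rewrite (@horner_coef_wide _ (size p)) ?size_poly //.
rewrite -(big_mkord xpredT
  (fun i => (map_poly (teval x') p)`_i * x ord_max ^+ i)).
rewrite /index_iota subn0; apply: eq_bigr => i _.
rewrite coef_map /= SE mulr_suml big_map; apply: eq_bigr => m _.
rewrite /tmon /= -mulrA; congr (_ * _).
rewrite big_ord_recr /= ffunE unlift_none /=; congr (_ * _).
apply: eq_bigr => j _; congr (_ ^+ _); rewrite ffunE.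
have -> : widen_ord (leqnSn n) j = lift ord_max j.
  by apply: val_inj; rewrite /= /bump leqNgt ltn_ord.
by rewrite liftK.
Qed.

Lemma tpf_monomials n (f : tpfun R n) : exists s : seq (monomial R n),
  forall x, tpf_eval f x = \sum_(m <- s) tmon m (x 0).
Proof.
by have [s sE] := teval_monomials (repr f); exists s => x; apply: sE.
Qed.

Lemma tmon_realized n (m : monomial R n) :
  exists f : tpfun R n, forall x, tpf_eval f x = tmon m (x 0).
Proof.
suff [p pE] : exists p : tpoly R n, forall x, teval x p = \prod_j x j ^+ m.2 j.
  exists (\pi_(tpfun R n) (tpolyC n (tfin m.1) * p))%qT => x.
  by rewrite tpf_eval_pi rmorphM /= tevalC pE.
elim: n {m}(m.2 : 'I_n -> nat) => [|n IHn] e.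
  by exists 1 => x; rewrite rmorph1 big_ord0.
have [p pE] := IHn (fun j => e (widen_ord (leqnSn n) j)).
exists (p%:P * 'X^(e ord_max)) => x.
rewrite /= rmorphM /= map_polyC map_polyXn hornerM hornerC hornerXn.
by rewrite big_ord_recr /= pE.
Qed.

(** Let [x] have infinite coordinates, and replace them by a very negative real
    [t].  A monomial that is finite at [x] does not involve these coordinates,
    so its value does not change; a monomial that involves one of them becomes
    too small to dominate it. *)
Lemma tle_everywhere n (f g : tpfun R n) :
  (forall y : 'rV[R]_n, tle (tpf_eval f (map_mx (@tfin R) y))
                            (tpf_eval g (map_mx (@tfin R) y))) ->
  forall x, tle (tpf_eval f x) (tpf_eval g x).
Proof.
have [[sf fE] [sg gE]] := (tpf_monomials f, tpf_monomials g).
move=> fg x; rewrite fE; apply: tle_sum => m sm.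
case mx: (tmon m (x 0)) => [c|] //.
(* [B w] is the value of [w] with the infinite coordinates set to 0, and [W w]
   its total degree in them. *)
pose B (w : monomial R n) := w.1 + \sum_j odflt 0 (x 0 j) *+ w.2 j.
pose W (w : monomial R n) := (\sum_(j | x 0%R j == None) w.2 j)%N.
pose t : R := - (1 + \sum_(w <- sg) `|B w| + `|c|).
pose y : 'rV[R]_n := \row_j (odflt 0 (x 0 j) + if x 0 j == None then t else 0).
have rmon_y w : rmon w y = B w + t * (W w)%:R.
  rewrite /rmon /B -addrA; congr (_ + _).
  rewrite /W natr_sum mulr_sumr [X in _ = _ + X]big_mkcond -big_split /=.
  apply: eq_bigr => j _; rewrite mxE mulrnDl.
  by case: ifP => _; rewrite ?mul0rn // mulr_natr.
have tmon_W0 w : W w = 0%N -> tmon w (x 0) = tfin (rmon w y).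
  move=> /eqP; rewrite sum_nat_eq0 => /forallP W0.
  rewrite -tmon_fin; congr (_ * _); apply: eq_bigr => j _.
  rewrite !mxE; have := W0 j; case: (x 0 j) => [r|] /=; first by rewrite addr0.
  by move=> /eqP ->.
have Wm : W m = 0%N.
  apply/eqP; rewrite sum_nat_eq0; apply/forallP => j; apply/implyP => /eqP xj.
  move: mx; rewrite /tmon (bigD1 j) //= [x 0 j](xj : _ = 0).
  case: (m.2 j) => // e.
  by rewrite expr0n /= mulr0n mul0r mulr0.
have := fg y; rewrite fE gE => le_y.
have : tle (tfin c) (\sum_(w <- sg) tmon w (map_mx (@tfin R) y 0)).
  apply: tle_trans le_y; have <- : tmon m (map_mx (@tfin R) y 0) = tfin c.
    by rewrite tmon_fin -tmon_W0.
  exact: (tle_sum_term (fun w => tmon w (map_mx (@tfin R) y 0))).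
move=> /tle_fin_sum[w sw]; rewrite tmon_fin => cw.
have Ww : W w = 0%N.
  apply/eqP; rewrite -leqn0 leqNgt; apply/negP; rewrite -(ltr_nat R) => W1.
  move: cw; rewrite /= rmon_y leNgt => /negP; apply.
  have : `|B w| <= \sum_(w <- sg) `|B w|.
    by rewrite (big_rem w) //= lerDl sumr_ge0.
  have := ler_norm (B w); have := ler_norm (- c); rewrite normrN.
  have W1' : 1 <= (W w)%:R :> R by rewrite ler1n -(ltr_nat R).
  have : 0 <= - t by rewrite opprK !addr_ge0 // sumr_ge0.
  rewrite /t; set S := \sum_(w <- sg) _ => t0; nra.
rewrite gE; apply: tle_trans (tle_sum_term (fun w => tmon w (x 0)) sw).
by rewrite tmon_W0.
Qed.

End Monomials.

(** * Pairs of polynomial functions separating a set *)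

Section Separation.
Variables (R : realType) (n : nat).
Implicit Types (f g h p q : tpfun R n) (V : set 'rV[R]_n).
Local Notation emb := (map_mx (@tfin R)).

(** The finiteness of [p] is required at all points of [R^n], not only on [V],
    so that it passes to unions; that of [q] on [V] follows.  The bound is
    multiplicative notation for [h - g <= k.+1 (p - q)]. *)
Record separates V p q : Prop := Separates {
  separates_le : forall x, tle (tpf_eval q x) (tpf_eval p x);
  separates_fin : forall y, tpf_eval p (emb y) != 0;
  separates_eq : forall y, V y -> tpf_eval p (emb y) = tpf_eval q (emb y);
  separates_bound : forall g h,
    (forall y, V y -> tle (tpf_eval h (emb y)) (tpf_eval g (emb y))) ->
    exists k : nat, forall x,
      tle (tpf_eval h x * tpf_eval q x ^+ k.+1)
          (tpf_eval g x * tpf_eval p x ^+ k.+1) }.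

Lemma tle_pow_weaken (a b c d : trop R) i j : tle c d -> (i <= j)%N ->
  tle (a * c ^+ i) (b * d ^+ i) -> tle (a * c ^+ j) (b * d ^+ j).
Proof.
move=> cd /subnKC <- le_i; rewrite !exprD !mulrA.
by apply: tle_mul => //; apply: tle_exp.
Qed.

(** With [q = -oo] the gap is infinite, and dominates everything. *)
Lemma separates_set0 : separates set0 1 0.
Proof.
split=> // [x|y|g h _]; first by rewrite tpf_eval0.
  by rewrite tpf_eval1 oner_neq0.
by exists 0%N => x; rewrite tpf_eval0 expr1 mulr0.
Qed.

(** The gap of the new pair is the minimum of the two gaps:
    [p + p' - max(q + p', q' + p) = min(p - q, p' - q')]. *)
Lemma separates_setU V V' p q p' q' :
  separates V p q -> separates V' p' q' ->
  separates (V `|` V') (p * p') (q * p' + q' * p).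
Proof.
move=> [le1 fin1 eq1 bd1] [le2 fin2 eq2 bd2]; split.
- move=> x; rewrite tpf_evalD !tpf_evalM; apply: tle_add.
    by apply: tle_mul; rewrite ?tle_refl.
  by rewrite mulrC; apply: tle_mul; rewrite ?tle_refl.
- by move=> y; rewrite tpf_evalM tmul_neq0.
- move=> y Vy; rewrite tpf_evalD !tpf_evalM; apply/esym.
  case: Vy => [/eq1 <-|/eq2 <-].
    rewrite addrC [X in X + _]mulrC.
    by apply/tle_addP/tle_mul; rewrite ?tle_refl.
  rewrite [_ * tpf_eval p _]mulrC.
  by apply/tle_addP/tle_mul; rewrite ?tle_refl.
- move=> g h gh.
  have [k1 kE1] := bd1 g h (fun y Vy => gh y (or_introl Vy)).
  have [k2 kE2] := bd2 g h (fun y Vy => gh y (or_intror Vy)).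
  exists (k1 + k2)%N => x; rewrite tpf_evalD !tpf_evalM.
  set u := tpf_eval p x; set u' := tpf_eval p' x.
  case: (tadd_total (tpf_eval q x * u') (tpf_eval q' x * u)) => ->.
    rewrite !exprMn !mulrA; apply: tle_mul; rewrite ?tle_refl //.
    by apply: tle_pow_weaken (kE1 x); rewrite // ltnS leq_addr.
  rewrite [u * u']mulrC !exprMn !mulrA; apply: tle_mul; rewrite ?tle_refl //.
  by apply: tle_pow_weaken (kE2 x); rewrite // ltnS leq_addl.
Qed.

Definition cell (cs : seq (monomial R n * monomial R n)) : set 'rV[R]_n :=
  [set y | {in cs, forall c, rmon c.1 y <= rmon c.2 y}].

Definition mon_aff (m : monomial R n) : 'rV[R]_n * R :=
  (\row_j (m.2 j)%:R, m.1).

Lemma mon_affE m y : aff (mon_aff m) y = rmon m y.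
Proof.
rewrite /aff /rmon addrC; congr (_ + _); apply: eq_bigr => j _.
by rewrite mxE mulr_natl.
Qed.

Lemma affB (l l' : 'rV[R]_n * R) y :
  aff (l.1 - l'.1, l.2 - l'.2) y = aff l y - aff l' y.
Proof.
rewrite /aff /= opprD addrACA; congr (_ + _).
by rewrite -sumrB; apply: eq_bigr => j _; rewrite !mxE mulrBl.
Qed.

(** With [p] the product of the [m+ + m-] and [q] that of the [m-], the gap
    [p - q] is the sum of the [max(0, m+ - m-)], that is, the total violation
    of the inequalities [m+ <= m-] that define the cell.  An empty cell needs
    another pair, as this gap may then be bounded. *)
Lemma separates_cell cs : exists p q, separates (cell cs) p q.
Proof.
have [[y0 Cy0]|C0] := pselect (exists y, cell cs y); last first.
  have -> : cell cs = set0 by apply/seteqP; split=> // y Cy; case: C0; exists y.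
  by exists 1, 0; apply: separates_set0.
have /choice[F FE] := @tmon_realized R n.
pose p := \prod_(c <- cs) (F c.1 + F c.2); pose q := \prod_(c <- cs) F c.2.
pose Q y := \sum_(c <- cs) rmon c.2 y.
pose D y := \sum_(c <- cs) Num.max 0 (rmon c.1 y - rmon c.2 y).
have qE y : tpf_eval q (emb y) = tfin (Q y).
  rewrite tpf_eval_prod -tfin_prod; apply: eq_bigr => c _.
  by rewrite FE tmon_fin.
have pE y : tpf_eval p (emb y) = tfin (Q y + D y).
  rewrite tpf_eval_prod -big_split -tfin_prod; apply: eq_bigr => c _ /=.
  rewrite tpf_evalD !FE !tmon_fin.
  rewrite -[LHS]/(tfin (Num.max (rmon c.1 y) (rmon c.2 y))); congr tfin.
  by rewrite addr_maxr addr0 addrC subrK maxC.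
exists p, q; split.
- move=> x; rewrite !tpf_eval_prod; elim/big_ind2: _ => [|a b a' b'|c _].
  + exact: tle_refl.
  + exact: tle_mul.
  + by rewrite tpf_evalD addrC tle_addl.
- by move=> y; rewrite pE.
- move=> y Cy; rewrite pE qE /D big_seq big1 ?addr0 // => c csc.
  by rewrite max_l // subr_le0 Cy.
move=> g h gh.
have [[G GE] [H HE]] := (tpf_monomials g, tpf_monomials h).
pose ls := [seq ((mon_aff c.1).1 - (mon_aff c.2).1,
                 (mon_aff c.1).2 - (mon_aff c.2).2) | c <- cs].
have lsP y : {in ls, forall l, aff l y <= 0} <-> cell cs y.
  split=> [ly c csc|Cy _ /mapP[c csc ->]].
    rewrite -subr_le0 -!mon_affE -affB; apply: ly.
    exact: (map_f (fun c => ((mon_aff c.1).1 - (mon_aff c.2).1,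
                 (mon_aff c.1).2 - (mon_aff c.2).2))).
  by rewrite affB !mon_affE subr_le0 Cy.
have dom u : exists K : nat, u \in H -> forall y, exists2 v, v \in G &
    rmon u y <= rmon v y + K%:R * D y.
  have [Hu|] := boolP (u \in H); last by exists 0%N.
  have [||K KE] := @affine_domination R n ls (map mon_aff G) (mon_aff u).
  - by exists y0; apply/lsP.
  - move=> y /lsP Cy; have := gh y Cy; rewrite GE HE => HG.
    have : tle (tfin (rmon u y)) (\sum_(m <- G) tmon m (emb y 0)).
      rewrite -tmon_fin; apply: tle_trans HG.
      exact: (tle_sum_term (fun w => tmon w (emb y 0))).
    move=> /tle_fin_sum[v Gv]; rewrite tmon_fin /= => uv.
    by exists (mon_aff v); rewrite ?map_f // !mon_affE.
  exists K => _ y; have [_ /mapP[v Gv ->]] := KE y; rewrite !mon_affE => uv.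
  exists v => //; move: uv; rewrite big_map /D.
  by under eq_bigr do rewrite affB !mon_affE.
have /choice[K KE] := dom.
(* Every [K u] with [u] in [H] is at most the sum of them all. *)
exists (\sum_(u <- H) K u)%N => x; set k := (_.+1).
rewrite -!tpf_evalX -!tpf_evalM; move: x; apply: tle_everywhere => y.
rewrite !tpf_evalM !tpf_evalX qE pE !tfinX HE mulr_suml.
apply: tle_sum => u Hu; rewrite tmon_fin.
have [v Gv uv] := KE u Hu y.
apply: (@tle_trans _ (tfin (rmon v y) * tfin ((Q y + D y) *+ k))); last first.
  apply: tle_mul; rewrite ?tle_refl // GE -tmon_fin.
  exact: (tle_sum_term (fun w => tmon w (emb y 0))).
change (rmon u y + Q y *+ k <= rmon v y + (Q y + D y) *+ k).
rewrite mulrnDl addrC [leRHS]addrCA lerD2l.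
apply: le_trans uv _; rewrite lerD2l -[D y *+ k]mulr_natl ler_wpM2r ?ler_nat //.
  by apply: sumr_ge0 => c _; rewrite le_max lexx.
by rewrite /k (big_rem u) //= -addSn ltnW // ltnS leq_addr.
Qed.

(** Exponents of tropical monomials are natural numbers, so a rational linear
    form is scaled to an integral one and its positive and negative parts are
    separated. *)
Lemma clear_denominators (c : 'I_n -> rat) :
  exists (d : nat) (e e' : 'I_n -> nat), (0 < d)%N /\
    forall j, d%:R * ratr (c j) = (e j)%:R - (e' j)%:R :> R.
Proof.
pose d := (\prod_j `|denq (c j)|)%N.
have /choice[z zE] j : exists z : int, d%:R * c j = z%:~R.
  exists ((\prod_(i < n | i != j) `|denq (c i)|)%N%:Z * numq (c j)).
  rewrite /d (bigD1 j) //= natrM intrM numqE.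
  have -> : (`|denq (c j)|%N)%:R = (denq (c j))%:~R :> rat.
    by rewrite -[in RHS](gez0_abs (denq_ge0 (c j))).
  by rewrite -pmulrn; ring.
exists d, (fun j => if z j is Posz m then m else 0%N),
  (fun j => if z j is Negz m then m.+1 else 0%N); split=> [|j].
  by rewrite prodn_gt0 // => j; rewrite absz_gt0 denq_neq0.
have -> : d%:R * ratr (c j) = (z j)%:~R :> R.
  by rewrite -(ratr_int R) -zE rmorphM /= ratr_nat.
by case: (z j) => m; rewrite ?subr0 // NegzE sub0r mulrNz.
Qed.

Lemma rational_polyhedral_cell V :
  rational_polyhedral V -> exists cs, V = cell cs.
Proof.
move=> [m [c [a ->]]].
have /choice[C CE] i : exists C : monomial R n * monomial R n,
    forall y : 'rV[R]_n,
    (\sum_(j < n) ratr (c i j) * y 0 j + a i <= 0) = (rmon C.1 y <= rmon C.2 y).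
  have [d [e [e' [d0 deE]]]] := clear_denominators (c i).
  exists ((d%:R * a i, [ffun j => e j]), (0, [ffun j => e' j])) => y.
  rewrite /rmon /= add0r -[RHS]subr_le0.
  rewrite -(pmulr_rle0 _ (_ : 0 < d%:R)) ?ltr0n //; congr (_ <= 0).
  rewrite mulrDr addrC -addrA; congr (_ + _); rewrite mulr_sumr -sumrB.
  apply: eq_bigr => j _; rewrite !ffunE mulrA deE mulrBl.
  by rewrite -[y 0 j *+ e j]mulr_natl -[y 0 j *+ e' j]mulr_natl.
exists [seq C i | i <- enum 'I_m]; apply/seteqP; split=> y /= Py.
  by move=> _ /mapP[i _ ->]; rewrite -CE.
by move=> i; rewrite CE Py // map_f // mem_enum.
Qed.

Lemma separates_union V :
  rational_polyhedral_union V -> exists p q, separates V p q.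
Proof.
move=> [m [P [Pr ->]]]; elim: m P Pr => [|m IHm] P Pr.
  exists 1, 0; have -> : \bigcup_i P i = set0.
    by apply/seteqP; split=> // y [[]].
  exact: separates_set0.
have [p [q pq]] := IHm (fun i => P (lift ord0 i)) (fun i => Pr _).
have [cs PE] := rational_polyhedral_cell (Pr ord0).
have [p' [q' pq']] := separates_cell cs.
exists (p' * p), (q' * p + q * p').
have -> : \bigcup_i P i = P ord0 `|` \bigcup_i P (lift ord0 i).
  apply/seteqP; split=> y; last first.
    by move=> [Py|[i _ Py]]; [exists ord0 | exists (lift ord0 i)].
  move=> [i _]; have [j ->|->] := unliftP ord0 i; last by left.
  by right; exists j.
by apply: separates_setU => //; rewrite PE.
Qed.

End Separation.

(** * Congruences *)

Section Congruences.

Lemma gen_congruence_congr (S : comNzSemiRingType) (f g : S) :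
  is_congruence (gen_congruence f g).
Proof.
split.
- by move=> a E [[]].
- by move=> a b ab E [EC Efg]; apply: (congr_sym EC); apply: ab.
- move=> a b c ab bc E [EC Efg].
  by apply: (congr_trans EC) (ab E _) (bc E _).
- move=> a b c d ab cd E [EC Efg].
  by apply: (congr_add EC); [apply: ab|apply: cd].
- move=> a b c d ab cd E [EC Efg].
  by apply: (congr_mul EC); [apply: ab|apply: cd].
Qed.

Lemma gen_congruence_mem (S : comNzSemiRingType) (f g : S) :
  gen_congruence f g (f, g).
Proof. by move=> E [_]; apply. Qed.

Lemma congruence_exp (S : comNzSemiRingType) (E : set (S * S)) f g k :
  is_congruence E -> E (f, g) -> E (f ^+ k, g ^+ k).
Proof.
move=> EC fg; elim: k => [|k IHk]; first exact: congr_refl.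
by rewrite !exprS; apply: congr_mul.
Qed.

Variables (R : realType) (n : nat).

Lemma E1_congr (V : set 'rV[trop R]_n) : is_congruence (E1 V).
Proof.
split.
- by [].
- by move=> f g fg x Vx; rewrite /= fg.
- by move=> f g h fg gh x Vx; rewrite /= fg //= gh.
- by move=> f g f' g' fg fg' x Vx /=; rewrite !tpf_evalD fg //= fg'.
- by move=> f g f' g' fg fg' x Vx /=; rewrite !tpf_evalM fg //= fg'.
Qed.

(** [g f2^k ~ g f1^k = g f1^k + h f2^k ~ g f2^k + h f2^k], where the equality
    says that [g f1^k] absorbs [h f2^k]. *)
Lemma congruence_squeeze (E : set (tpfun R n * tpfun R n)) f1 f2 g h k :
  is_congruence E -> E (f1, f2) ->
  (forall x, tle (tpf_eval h x * tpf_eval f2 x ^+ k)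
                 (tpf_eval g x * tpf_eval f1 x ^+ k)) ->
  E (g * f2 ^+ k, (g + h) * f2 ^+ k).
Proof.
move=> EC Ef le_hg.
have E12 : E (g * f2 ^+ k, g * f1 ^+ k).
  apply: (congr_mul EC); first exact: congr_refl.
  by apply: congruence_exp => //; apply: congr_sym.
apply: (congr_trans EC) E12 _.
have -> : g * f1 ^+ k = g * f1 ^+ k + h * f2 ^+ k.
  apply: tpf_evalP => x; rewrite tpf_evalD !tpf_evalM !tpf_evalX addrC.
  by apply/esym/tle_addP.
rewrite mulrDl; apply: (congr_add EC); last exact: congr_refl.
apply: (congr_mul EC); first exact: congr_refl.
exact: congruence_exp.
Qed.

Lemma separates_congruence (V : set 'rV[R]_n) f1 f2 g h :
  separates V f1 f2 -> E1 (in_trop V) (g, h) ->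
  exists k : nat, (0 < k)%N /\ gen_congruence f1 f2 (g * f2 ^+ k, h * f2 ^+ k).
Proof.
move=> sV gh; have EC := gen_congruence_congr f1 f2.
have Ef := @gen_congruence_mem _ f1 f2.
have ghV y : V y ->
    tpf_eval g (map_mx (@tfin R) y) = tpf_eval h (map_mx (@tfin R) y).
  by move=> Vy; apply: gh; exists y.
have [|k1 k1E] := @separates_bound _ _ _ _ _ sV g h.
  by move=> y /ghV ->; apply: tle_refl.
have [|k2 k2E] := @separates_bound _ _ _ _ _ sV h g.
  by move=> y /ghV ->; apply: tle_refl.
exists (k1 + k2).+1; split=> //.
set k := (k1 + k2).+1.
have gE : gen_congruence f1 f2 (g * f2 ^+ k, (g + h) * f2 ^+ k).
  apply: (congruence_squeeze EC Ef) => x; apply: tle_pow_weaken (k1E x).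
    exact: (separates_le sV).
  by rewrite ltnS leq_addr.
have hE : gen_congruence f1 f2 (h * f2 ^+ k, (h + g) * f2 ^+ k).
  apply: (congruence_squeeze EC Ef) => x; apply: tle_pow_weaken (k2E x).
    exact: (separates_le sV).
  by rewrite ltnS leq_addl.
by apply: (congr_trans EC gE); rewrite addrC; apply: (congr_sym EC hE).
Qed.

Lemma gen_congruence_E1 (V : set 'rV[trop R]_n) f1 f2 :
  E1 V (f1, f2) -> gen_congruence f1 f2 `<=` E1 V.
Proof. by move=> Vf gh; apply; split=> [|_ ->//]; apply: E1_congr. Qed.

End Congruences.

Theorem corollary1p4 (R : realType) (n : nat) (V : set 'rV[R]_n)
    (hV : rational_polyhedral_union V) :
  let represents (f1 f2 : tpfun R n) :=
    E1 (in_trop V) =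
      [set gh : tpfun R n * tpfun R n | exists k : nat, (0 < k)%N /\
        gen_congruence f1 f2 (gh.1 * f2 ^+ k, gh.2 * f2 ^+ k)] /\
    (forall x : 'rV[trop R]_n, tle (tpf_eval f2 x) (tpf_eval f1 x)) in
  (exists f1 f2 : tpfun R n, represents f1 f2) /\
  (forall (f1 f2 : tpfun R n) (c : R),
     represents f1 f2 -> f2 = tpf_const n (tfin c) ->
     E1 (in_trop V) = gen_congruence f1 f2).
Proof.
move=> represents; split.
  have [f1 [f2 sV]] := separates_union hV; exists f1, f2.
  split; last exact: (separates_le sV).
  apply/seteqP; split=> [[g h]|[g h] [k [_ /= kE]]].
    exact: separates_congruence.
  have Vf : E1 (in_trop V) (f1, f2).
    by move=> _ [y Vy <-]; exact: (separates_eq sV Vy).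
  move=> _ [y Vy <-] /=.
  have := gen_congruence_E1 Vf kE; move=> /(_ (map_mx (@tfin R) y)).
  move=> /(_ (ex_intro2 _ _ y Vy erefl)) /=; rewrite !tpf_evalM; apply: tmulIr.
  rewrite tpf_evalX -(separates_eq sV Vy).
  case: tpf_eval (separates_fin sV y) => // r _.
  by rewrite [_ ^+ k]tfinX.
move=> f1 f2 c [E1E _] f2E; have EC := gen_congruence_congr f1 f2.
apply/seteqP; split=> [[g h]|[g h] gh]; rewrite E1E.
  (* A real constant is invertible, so the power of [f2] can be cancelled inside
     the congruence. *)
  move=> [k [_ /= kE]].
  have cancel f : f * f2 ^+ k * tpf_const n (tfin (- c)) ^+ k = f.
    rewrite -mulrA -exprMn; have -> : f2 * tpf_const n (tfin (- c)) = 1.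
      apply: tpf_evalP => x; rewrite f2E tpf_evalM !tpf_evalC tpf_eval1.
      by rewrite -[LHS]/(tfin (c + - c)) subrr.
    by rewrite expr1n mulr1.
  rewrite -(cancel g) -(cancel h); apply: (congr_mul EC kE).
  exact: congr_refl.
by exists 1%N; split=> //=; apply: (congr_mul EC gh); apply: congr_refl.
Qed.
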